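(* Let $\nu:\mathbb{R}^n\to\mathbb{R}$ be a symmetric gauge function. The flow of the generalized Riccati differential equation on $S^n_{++}$ is non-expansive in the invariant Finsler metric $d_\nu$ for all admissible parameters $(A,B,C,D,L,Q,R)$ if and only if $\nu$ is a scalar multiple of the sup-norm $\lambda\mapsto\max_{1\leq i\leq n}|\lambda_i|$.
   Context: $S^n$ is the set of real symmetric $n\times n$ matrices, $S^n_{++}$ the positive definite ones; $'$ denotes transpose. A symmetric gauge function $\nu:\mathbb{R}^n\to\mathbb{R}$ is a convex, positively homogeneous function of degree 1 such that for every permutation $\sigma$, $\nu(\lambda_1,\dots,\lambda_n)=\nu(|\lambda_{\sigma(1)}|,\dots,|\lambda_{\sigma(n)}|)$ for all $\lambda\in\mathbb{R}^n$. Its spectral function is $\hat\nu(P)=\nu(\lambda(P))$, $P\in S^n$, with $\lambda(P)$ the vector of eigenvalues of $P$, and the associated metric on $S^n_{++}$ is $d_\nu(P,Q)=\hat\nu(\log(P^{-1/2}QP^{-1/2}))$. The generalized Riccati differential equation is $\dot P=\phi(P)$ on $S^n_{++}$ with $$\phi(P)=A'P+PA+C'PC+Q-(B'P+D'PC+L)'(R+D'PD)^{-1}(B'P+D'PC+L).$$ Admissible parameters are constant matrices $A,C\in\mathbb{R}^{n\times n}$, $B,D\in\mathbb{R}^{n\times k}$, $L\in\mathbb{R}^{k\times n}$, $Q\in S^n$, $R\in S^k$ ($k\geq1$ arbitrary) such that $\begin{pmatrix}Q&L'\\L&R\end{pmatrix}$ is positive semi-definite and $\ker R\cap\ker D=\{0\}$.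 $M_t(P)$ is the value at time $t$ of the maximal solution in $S^n_{++}$ starting at $P$ at time $0$; the flow is non-expansive in $d_\nu$ if $d_\nu(M_t(P_1),M_t(P_2))\leq d_\nu(P_1,P_2)$ for all $P_1,P_2\in S^n_{++}$ and all $t\geq0$ such that both solutions are defined on $[0,t]$. *)

(* Defs.v *)
From mathcomp Require Import all_boot all_order all_algebra all_fingroup.
From mathcomp Require Import all_classical all_reals all_analysis.

Set Implicit Arguments.
Unset Strict Implicit.
Unset Printing Implicit Defensive.

Import Order.TTheory GRing.Theory Num.Theory.
Import numFieldNormedType.Exports.

Local Open Scope classical_set_scope.
Local Open Scope ring_scope.

Section SymmetricMatrices.
Context {R : realType} {n : nat}.
Implicit Types (P Q X : 'M[R]_n).

Definition symmx P : Prop := P^T = P.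

Definition psdmx P : Prop :=
  symmx P /\ forall x : 'cV[R]_n, 0 <= (x^T *m P *m x) 0 0.

Definition pdmx P : Prop :=
  symmx P /\ forall x : 'cV[R]_n, x != 0 -> 0 < (x^T *m P *m x) 0 0.

(* The eigenvalues of P counted with multiplicity, in nonincreasing order;
   meaningful when char_poly P splits over R, in particular for symmetric P. *)
Definition eigenvals P : 'rV[R]_n :=
  xget 0 [set l : 'rV[R]_n |
    char_poly P = \prod_(i < n) ('X - (l 0 i)%:P) /\
    (forall i j : 'I_n, (i <= j)%N -> l 0 j <= l 0 i)].

(* Functional calculus on symmetric matrices: f (U' diag(d) U) is
   U' diag(f(d)) U for U orthogonal, whichever diagonalization is chosen. *)
Definition mxfun (f : R -> R) P : 'M[R]_n :=
  xget 0 [set X | exists U : 'M[R]_n, exists d : 'rV[R]_n,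
    [/\ U *m U^T = 1%:M,
        P = U^T *m diag_mx d *m U &
        X = U^T *m diag_mx (map_mx f d) *m U]].

Definition sqrtmx P : 'M[R]_n := mxfun Num.sqrt P.

Definition logmx P : 'M[R]_n := mxfun (@ln R) P.

End SymmetricMatrices.

Section GaugeMetric.
Context {R : realType} {n : nat}.
Implicit Type nu : 'rV[R]_n -> R.

Definition symmetric_gauge nu : Prop :=
  [/\ convex_function [set: convex_lmodType 'rV[R]_n] nu,
      forall (a : R) (l : 'rV[R]_n), 0 < a -> nu (a *: l) = a * nu l &
      forall (s : 'S_n) (l : 'rV[R]_n), nu l = nu (\row_i `|l 0 (s i)|)].

Definition spectral_fun nu (P : 'M[R]_n) : R := nu (eigenvals P).

Definition gauge_dist nu (P Q : 'M[R]_n) : R :=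
  spectral_fun nu
    (logmx (invmx (sqrtmx P) *m Q *m invmx (sqrtmx P))).

Definition sup_norm (l : 'rV[R]_n) : R := \big[Num.max/0]_(i < n) `|l 0 i|.

End GaugeMetric.

Record riccati_param (R : realType) (n k : nat) := RiccatiParam {
  rA : 'M[R]_n;
  rB : 'M[R]_(n, k);
  rC : 'M[R]_n;
  rD : 'M[R]_(n, k);
  rL : 'M[R]_(k, n);
  rQ : 'M[R]_n;
  rR : 'M[R]_k }.

Section Riccati.
Context {R : realType} {n k : nat}.
Variable p : riccati_param R n k.
Local Notation A := (rA p).
Local Notation B := (rB p).
Local Notation C := (rC p).
Local Notation D := (rD p).
Local Notation L := (rL p).
Local Notation Q := (rQ p).
Local Notation S := (rR p).

Definition admissible : Prop :=
  [/\ symmx Q, symmx S, psdmx (block_mx Q L^T L S) &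
      forall x : 'cV[R]_k, S *m x = 0 -> D *m x = 0 -> x = 0].

(* For admissible parameters and P positive definite, S + D' P D is positive
   definite, so invmx is a genuine inverse. *)
Definition riccati (P : 'M[R]_n) : 'M[R]_n :=
  A^T *m P + P *m A + C^T *m P *m C + Q
  - (B^T *m P + D^T *m P *m C + L)^T *m invmx (S + D^T *m P *m D)
      *m (B^T *m P + D^T *m P *m C + L).

(* X is a solution on the open time interval J, with values in the positive
   definite cone; its values outside J are irrelevant. *)
Definition riccati_solution (J : set R) (X : R -> 'M[R]_n) : Prop :=
  [/\ open J, is_interval J, J 0 &
      forall s : R, J s ->
        pdmx (X s) /\ is_derive s (1 : R) X (riccati (X s))].

Definition riccati_maximal (J : set R) (X : R -> 'M[R]_n) : Prop :=
  riccati_solution J X /\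
  forall (J' : set R) (X' : R -> 'M[R]_n),
    riccati_solution J' X' -> J `<=` J' ->
    (forall s, J s -> X' s = X s) -> J' `<=` J.

(* Graph of the partial map M_t: [riccati_flow t P Y] says that M_t(P) is
   defined and equal to Y. *)
Definition riccati_flow (t : R) (P Y : 'M[R]_n) : Prop :=
  exists J : set R, exists X : R -> 'M[R]_n,
    [/\ riccati_maximal J X, X 0 = P, J t & X t = Y].

Definition nonexpansive_flow (nu : 'rV[R]_n -> R) : Prop :=
  forall P1 P2 : 'M[R]_n, pdmx P1 -> pdmx P2 ->
  forall t : R, 0 <= t ->
  forall Y1 Y2 : 'M[R]_n, riccati_flow t P1 Y1 -> riccati_flow t P2 Y2 ->
    gauge_dist nu Y1 Y2 <= gauge_dist nu P1 P2.

End Riccati.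

(* Main.v *)
Require Import Defs.
From mathcomp Require Import all_boot all_order all_algebra all_fingroup.
From mathcomp Require Import all_classical all_reals all_analysis.
From mathcomp Require Import complex spectral ring lra.
Set Implicit Arguments.
Unset Strict Implicit.
Unset Printing Implicit Defensive.
Import Order.TTheory GRing.Theory Num.Theory.
Import numFieldNormedType.Exports.
Local Open Scope ring_scope.

(** Sup-norm implies non-expansive.  For the sup-norm the metric is Thompson's
    metric: d(P, Q) <= s iff Q <= e^s P and P <= e^s Q in the Loewner order
    ([thompsonP]), as one sees after writing P = G' G and Q = G' diag(mu) G.
    So it suffices that X2(0) <= lam X1(0) with lam >= 1 propagates along two
    solutions X1, X2 ([riccati_comparison]).  Completing the square shows that
    x' phi(P) x is the minimum over controls u in R^k of an expression which is
    the sum of a part linear in P and of a cost independent of P that is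
    non-negative ([riccati_form_le], [riccati_form_attained]).  Inserting into
    both forms the control that is optimal for X1 gives a differential
    inequality for Z = c X1 - X2, where c(s) = lam + eps (1 + s) is increasing
    and slightly larger than lam: if Z(s) is positive semi-definite, Z(s) x = 0
    and x is nonzero, then x' (dZ/ds) x >= eps x' X1(s) x > 0.  Hence Z can
    never leave the open cone of positive definite matrices ([first_exit]), and
    one lets eps tend to 0.  Perturbing by a multiple of X1, rather than of the
    identity, avoids any bound on the optimal feedback.

    Non-expansive implies sup-norm.  A symmetric gauge function is monotone in
    the absolute values of the coordinates, so it is a multiple of the sup-norm
    as soon as nu(1, ..., 1) <= nu(1, 0, ..., 0).  Take k = 1, R = 1,
    C = E_{0m} and all the other parameters equal to 0: the equation becomes
    dP/dt = P_00 E_mm, which feeds the first diagonal entry into the m-th one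
    ([feed_flow]).  Start from two diagonal matrices that have ratio e in the
    coordinates 0, ..., m-1 and equal entries elsewhere, very small in
    coordinate m.  Their distance is nu evaluated at m ones followed by zeros;
    at time 1 coordinate m has been overwhelmed by what it received, so its
    ratio is also almost e.  Non-expansiveness thus gives
    nu(1^(m+1), 0) <= nu(1^m, 0) ([initial_ones_le]), and one concludes by
    induction on m. *)

(** * Bilinear forms and definite matrices *)

Section BilinearForm.
Context {R : realType}.

Definition bform m n (P : 'M[R]_(m, n)) (x : 'cV[R]_m) (y : 'cV[R]_n) : R :=
  (x^T *m P *m y) 0 0.

Lemma bformE m n (P : 'M[R]_(m, n)) x y :
  bform P x y = \sum_i \sum_j x i 0 * P i j * y j 0.
Proof.
rewrite /bform !mxE exchange_big /=; apply: eq_bigr => j _.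
by rewrite !mxE mulr_suml; apply: eq_bigr => i _; rewrite !mxE.
Qed.

Lemma bformDl m n (P : 'M[R]_(m, n)) x x' y :
  bform P (x + x') y = bform P x y + bform P x' y.
Proof. by rewrite /bform linearD /= !mulmxDl mxE. Qed.

Lemma bformDr m n (P : 'M[R]_(m, n)) x y y' :
  bform P x (y + y') = bform P x y + bform P x y'.
Proof. by rewrite /bform !mulmxDr mxE. Qed.

Lemma bformZl m n (P : 'M[R]_(m, n)) a x y :
  bform P (a *: x) y = a * bform P x y.
Proof. by rewrite /bform linearZ /= -!scalemxAl mxE. Qed.

Lemma bformZr m n (P : 'M[R]_(m, n)) a x y :
  bform P x (a *: y) = a * bform P x y.
Proof. by rewrite /bform -!scalemxAr mxE. Qed.

Lemma bformD m n (P P' : 'M[R]_(m, n)) x y :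
  bform (P + P') x y = bform P x y + bform P' x y.
Proof. by rewrite /bform mulmxDr mulmxDl mxE. Qed.

Lemma bformN m n (P : 'M[R]_(m, n)) x y : bform (- P) x y = - bform P x y.
Proof. by rewrite /bform mulmxN mulNmx mxE. Qed.

Lemma bformZ m n (P : 'M[R]_(m, n)) a x y :
  bform (a *: P) x y = a * bform P x y.
Proof. by rewrite /bform -scalemxAr -scalemxAl mxE. Qed.

Lemma bform0 m n (P : 'M[R]_(m, n)) x : bform P x 0 = 0.
Proof. by rewrite /bform mulmx0 mxE. Qed.

Lemma bform_tr m n (P : 'M[R]_(m, n)) x y : bform P^T y x = bform P x y.
Proof.
rewrite !bformE exchange_big /=; apply: eq_bigr => i _; apply: eq_bigr => j _.
by rewrite mxE; ring.
Qed.

Lemma bform_mulr m n p (P : 'M[R]_(m, n)) (M : 'M[R]_(n, p)) x y :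
  bform (P *m M) x y = bform P x (M *m y).
Proof. by rewrite /bform !mulmxA. Qed.

Lemma bform_mull m n p (P : 'M[R]_(m, n)) (M : 'M[R]_(p, m)) x y :
  bform (M *m P) x y = bform P (M^T *m x) y.
Proof. by rewrite /bform trmx_mul trmxK !mulmxA. Qed.

Lemma bform_block m n (P : 'M[R]_m) (P12 : 'M[R]_(m, n)) (P21 : 'M[R]_(n, m))
    (P2 : 'M[R]_n) x u :
  bform (block_mx P P12 P21 P2) (col_mx x u) (col_mx x u) =
  bform P x x + bform P21 u x + (bform P12 x u + bform P2 u u).
Proof.
rewrite /bform tr_col_mx mul_row_block mul_row_col !mulmxDl.
by rewrite mxE [X in X + _]mxE [X in _ + X]mxE.
Qed.

Lemma bform_sym n (P : 'M[R]_n) x y : symmx P -> bform P x y = bform P y x.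
Proof. by move=> sP; rewrite -bform_tr sP. Qed.

Definition sqnorm n (x : 'cV[R]_n) : R := \sum_i x i 0 ^+ 2.

Lemma bform1 n (x : 'cV[R]_n) : bform 1%:M x x = sqnorm x.
Proof.
by rewrite /bform mulmx1 mxE; apply: eq_bigr => i _; rewrite !mxE expr2.
Qed.

Lemma sqnorm_ge0 n (x : 'cV[R]_n) : 0 <= sqnorm x.
Proof. by apply: sumr_ge0 => i _; apply: sqr_ge0. Qed.

Lemma sqnorm_eq0 n (x : 'cV[R]_n) : (sqnorm x == 0) = (x == 0).
Proof.
apply/eqP/eqP => [x0|->];
  last by rewrite /sqnorm big1// => i _; rewrite mxE expr0n.
apply/colP => i; rewrite mxE; apply/eqP; rewrite -sqrf_eq0; apply/eqP.
by apply: (psumr_eq0P _ x0) => // j _; apply: sqr_ge0.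
Qed.

Lemma sqnorm_gt0 n (x : 'cV[R]_n) : (0 < sqnorm x) = (x != 0).
Proof. by rewrite lt_def sqnorm_ge0 andbT sqnorm_eq0. Qed.

Lemma psd_bform n (P : 'M[R]_n) : psdmx P -> forall x, 0 <= bform P x x.
Proof. by case. Qed.

Lemma pd_bform n (P : 'M[R]_n) : pdmx P -> forall x, x != 0 -> 0 < bform P x x.
Proof. by case. Qed.

Lemma pd_psd n (P : 'M[R]_n) : pdmx P -> psdmx P.
Proof.
case=> sP hP; split => // x; have [->|/hP/ltW//] := eqVneq x 0.
by rewrite mulmx0 mxE.
Qed.

(** Moving from an isotropic x in a direction y changes the form by
    2 t bform P y x to first order in t, so non-negativity forces P x to be
    orthogonal to every y. *)
Lemma psd_ker n (P : 'M[R]_n) (x : 'cV[R]_n) :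
  psdmx P -> bform P x x = 0 -> P *m x = 0.
Proof.
move=> psdP Px0; have sP := psdP.1.
suff h y : bform P y x = 0.
  apply/eqP; rewrite -sqnorm_eq0 -bform1; apply/eqP.
  by rewrite -bform_mulr mul1mx h.
apply/eqP; apply: contraT => yx0.
set a := bform P y x in yx0; set b := bform P y y.
have b0 : 0 <= b by apply: psd_bform.
(* The minimizer is - a / b, but b may vanish. *)
pose t := - a / (b + 1).
have := psd_bform psdP (x + t *: y).
rewrite !bformDl !bformDr !bformZl !bformZr Px0 (bform_sym x y sP) -/a -/b.
have b1 : 0 < b + 1 by rewrite ltr_wpDl.
have -> : 0 + t * a + (t * a + t * (t * b)) =
    - (a ^+ 2 * (b + 2)) / (b + 1) ^+ 2.
  by rewrite /t; field; rewrite gt_eqF.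
rewrite pmulr_lge0 ?invr_gt0 ?exprn_gt0// oppr_ge0 leNgt mulr_gt0//.
  by rewrite lt_def sqrf_eq0 yx0 sqr_ge0.
by rewrite ltr_wpDl.
Qed.

Lemma psd_not_pd n (P : 'M[R]_n) :
  psdmx P -> ~ pdmx P -> exists2 x : 'cV[R]_n, x != 0 & P *m x = 0.
Proof.
move=> psdP npd; apply: contrapT => nex; apply: npd; split; first exact: psdP.1.
move=> x x0; rewrite lt_def psdP.2 andbT; apply/eqP => Px.
by apply: nex; exists x => //; apply: psd_ker.
Qed.

Lemma pd_unit n (P : 'M[R]_n) : pdmx P -> P \in unitmx.
Proof.
move=> pdP; rewrite -row_free_unit -kermx_eq0; apply/eqP/row_matrixP => i.
rewrite row0; set v := row i _; apply/eqP; apply: contraT => v0.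
have := pd_bform pdP (x := v^T); rewrite trmx_eq0 v0 => /(_ isT).
have vP : v *m P = 0 by rewrite -row_mul mulmx_ker row0.
by rewrite /bform trmxK vP mul0mx mxE ltxx.
Qed.

Lemma symmx_inv n (P : 'M[R]_n) : symmx P -> symmx (invmx P).
Proof. by rewrite /symmx trmx_inv => ->. Qed.

End BilinearForm.

(** * The spectral theorem for real symmetric matrices *)

Section SpectralTheorem.
Context {R : realType}.

(** The complexification of P is Hermitian, so its eigenvalues are real; a real
    root of its characteristic polynomial is one of that of P, hence it has a
    real eigenvector. *)
Lemma sym_eigenvector n (P : 'M[R]_n.+1) : symmx P ->
  exists a (v : 'rV[R]_n.+1), v != 0 /\ v *m P = a *: v.
Proof.
move=> sP; pose f : R -> R[i] := real_complex R.
pose PC := map_mx (real_complex R) P.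
have hPC : PC \is hermsymmx.
  apply: realsym_hermsym.
    apply/is_hermitianmxP; rewrite expr0 scale1r; apply/matrixP => i j.
    by rewrite !mxE /= -[in LHS]sP mxE.
  by apply/mxOverP => i j; rewrite mxE complex_real.
have /mxOverP/(_ 0 0)/complex_realP[a aE] := hermitian_spectral_diag_real hPC.
have /orthomx_spectralP PE := hermitian_normalmx hPC.
have UPC : spectralmx PC *m PC = diag_mx (spectral_diag PC) *m spectralmx PC.
  by rewrite {2}PE !mulmxA mulmxV ?spectral_unit// mul1mx.
have /eigenvalueP[v vP v0] : eigenvalue P a.
  rewrite eigenvalue_root_char -(fmorph_root (real_complex R)) map_char_poly.
  rewrite -eigenvalue_root_char; apply/eigenvalueP.
  exists (row 0 (spectralmx PC)).
    by rewrite -row_mul UPC row_mul row_diag_mx -scalemxAl -rowE aE.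
  apply/eqP => r0; have := spectral_unit PC.
  rewrite -row_free_unit => /row_freeP[B /(congr1 (row 0))].
  rewrite row_mul r0 mul0mx => /rowP/(_ 0); rewrite !mxE eqxx => /eqP.
  by rewrite eq_sym oner_eq0.
by exists a, v.
Qed.

(** The reflection exchanging v and the first basis vector: its rows complete v
    to an orthonormal basis. *)
Lemma householder n (v : 'rV[R]_n.+1) : v *m v^T = 1%:M ->
  exists H : 'M[R]_n.+1, [/\ H^T = H, H *m H = 1%:M & delta_mx 0 0 *m H = v].
Proof.
move=> vv; pose e : 'rV[R]_n.+1 := delta_mx 0 0.
have [<-|ve] := eqVneq e v.
  by exists 1%:M; rewrite trmx1 !mulmx1.
pose w := v - e; pose c := (w *m w^T) 0 0.
have wwT : w *m w^T = c%:M by apply/rowP => i; rewrite !ord1 [RHS]mxE mulr1n.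
have c0 : c != 0.
  have := sqnorm_eq0 (w^T); rewrite trmx_eq0 subr_eq0.
  rewrite [v == e]eq_sym (negbTE ve) => /negbT.
  by rewrite -bform1 /bform trmxK mulmx1.
have ee : e *m e^T = 1%:M 
  by apply/rowP => i; rewrite !ord1 /e trmx_delta mul_delta_mx !mxE.
have ev : e *m v^T = (v 0 0)%:M.
  by apply/rowP => i; rewrite !ord1 -rowE !mxE.
have ve' : v *m e^T = (v 0 0)%:M.
  by rewrite -[LHS]trmxK trmx_mul trmxK ev tr_scalar_mx.
have cE : c = 2 * (1 - v 0 0).
  rewrite /c /w linearB /= mulmxBl !mulmxBr vv ee ev ve' !mxE !mulr1n.
  by ring.
pose H := 1%:M - (2 / c) *: (w^T *m w).
exists H; split.
- by rewrite /H linearB linearZ /= trmx1 trmx_mul trmxK.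
- have : w^T *m w *m (w^T *m w) = c *: (w^T *m w).
    by rewrite mulmxA -[w^T *m w *m w^T]mulmxA wwT mul_mx_scalar -scalemxAl.
  rewrite /H; move: (w^T *m w) => W WW.
  rewrite mulmxBl !mulmxBr !mul1mx !mulmx1 -scalemxAl -scalemxAr WW.
  by apply/matrixP => i j; rewrite !mxE; field.
- rewrite -/e /H mulmxBr mulmx1 -scalemxAr mulmxA.
  have -> : e *m w^T = (v 0 0 - 1)%:M.
    by rewrite /w linearB /= mulmxBr ev ee -raddfB.
  rewrite mul_scalar_mx scalerA.
  have -> : 2 / c * (v 0 0 - 1) = - 1.
    have : 2 * (1 - v 0 0) != 0 by rewrite -cE.
    rewrite cE => h; field.
    by move: h; rewrite mulf_eq0 negb_or => /andP[].
  by rewrite scaleN1r opprK /w addrC subrK.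
Qed.

(** A reflection sending an eigenvector to the first basis vector conjugates P
    to a block-diagonal symmetric matrix, and induction applies to the second
    block. *)
Theorem spectral_theorem n (P : 'M[R]_n) : symmx P ->
  exists (U : 'M[R]_n) (d : 'rV[R]_n),
    U *m U^T = 1%:M /\ P = U^T *m diag_mx d *m U.
Proof.
elim: n P => [|n IH] P sP.
  by exists 1%:M, 0; split; apply/matrixP; case.
have [a [v0 [v0N v0P]]] := sym_eigenvector sP.
pose r := Num.sqrt ((v0 *m v0^T) 0 0).
have vv0 : 0 < (v0 *m v0^T) 0 0.
  have := sqnorm_gt0 v0^T; rewrite trmx_eq0 v0N.
  by rewrite -bform1 /bform trmxK mulmx1.
have r0 : 0 < r by rewrite sqrtr_gt0.
pose v := r^-1 *: v0.
have vP : v *m P = a *: v by rewrite -scalemxAl v0P /v !scalerA mulrC.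
have vv : v *m v^T = 1%:M.
  rewrite /v linearZ /= -scalemxAl -scalemxAr scalerA; apply/rowP => i.
  have vvr : (v0 *m v0^T) 0 0 = r ^+ 2 by rewrite sqr_sqrtr// ltW.
  rewrite !ord1 mxE vvr mxE mulr1n; field; exact: lt0r_neq0.
have [H [HT HH eH]] := householder vv.
pose M : 'M[R]_(1 + n) := H *m P *m H.
have MT : M^T = M by rewrite /M !trmx_mul HT sP mulmxA.
have vH : v *m H = delta_mx 0 0 by rewrite -eH -mulmxA HH mulmx1.
have eM : delta_mx 0 0 *m M = a *: delta_mx 0 0 :> 'rV[R]_(n.+1).
  by rewrite /M !mulmxA eH vP -scalemxAl vH.
have urM : ursubmx M = 0.
  apply/matrixP => i j; rewrite !mxE !ord1.
  have /rowP/(_ (rshift 1 j)) := eM; rewrite -rowE !mxE /=.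
  have -> : lshift n 0 = 0 :> 'I_(1 + n) by apply/val_inj.
  by move=> ->; rewrite mulr0.
have dlM : dlsubmx M = 0 by rewrite -[LHS]trmxK trmx_dlsub MT urM trmx0.
have sM1 : symmx (drsubmx M) by rewrite /symmx trmx_drsub MT.
have [U1 [d1 [UU1 M1E]]] := IH _ sM1.
have ME : M = block_mx (ulsubmx M) 0 0 (drsubmx M).
  by rewrite -[LHS]submxK urM dlM.
pose U0 : 'M[R]_(1 + n) := block_mx 1%:M 0 0 U1.
have UU0 : U0 *m U0^T = 1%:M.
  rewrite /U0 tr_block_mx mulmx_block !trmx0 trmx1 !mulmx0 !mul0mx !mulmx1.
  by rewrite !addr0 !add0r UU1 -scalar_mx_block.
pose d : 'rV[R]_(1 + n) := row_mx (ulsubmx M) d1.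
have M2 : M = U0^T *m diag_mx d *m U0.
  rewrite ME /U0 /d diag_mx_row tr_block_mx !mulmx_block !trmx0 trmx1.
  rewrite !mulmx0 !mul0mx !mulmx1 !mul1mx !addr0 !add0r !mul0mx -M1E.
  congr block_mx; apply/matrixP => i j; rewrite !ord1 !mxE eqxx mulr1n.
  done.
exists (U0 *m H), d; split.
  by rewrite trmx_mul HT mulmxA -[U0 *m H *m H]mulmxA HH mulmx1.
rewrite trmx_mul HT -!mulmxA [diag_mx d *m _]mulmxA [U0^T *m _]mulmxA.
rewrite [U0^T *m _]mulmxA -M2 /M !mulmxA HH mul1mx -mulmxA HH mulmx1//.
Qed.

Lemma orthodiag_bform n (U : 'M[R]_n) (d : 'rV[R]_n) (x : 'cV[R]_n) :
  bform (U^T *m diag_mx d *m U) x x = \sum_i d 0 i * ((U *m x) i 0) ^+ 2.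
Proof.
rewrite bform_mulr bform_mull trmxK /bform mul_mx_diag !mxE.
by apply: eq_bigr => i _; rewrite !mxE; ring.
Qed.

Lemma pd_spectral n (P : 'M[R]_n) : pdmx P ->
  exists (U : 'M[R]_n) (d : 'rV[R]_n),
    [/\ U *m U^T = 1%:M, P = U^T *m diag_mx d *m U & forall i, 0 < d 0 i].
Proof.
move=> pdP; have [U [d [UU PE]]] := spectral_theorem pdP.1.
exists U, d; split => // i.
have : 0 < bform P (U^T *m delta_mx i 0) (U^T *m delta_mx i 0).
  apply: pd_bform => //; apply/eqP => /(congr1 (mulmx U)).
  rewrite mulmxA UU mul1mx mulmx0 => /colP/(_ i); rewrite !mxE !eqxx => /eqP.
  by rewrite oner_eq0.
rewrite PE orthodiag_bform mulmxA UU mul1mx (bigD1 i)//= big1 ?addr0.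
  by rewrite !mxE !eqxx expr1n mulr1.
by move=> j ji; rewrite mxE (negbTE ji) expr0n mulr0.
Qed.

Lemma pd_coercive n (P : 'M[R]_n) : pdmx P ->
  exists2 c : R, 0 < c & forall x, c * sqnorm x <= bform P x x.
Proof.
move=> /pd_spectral[U [d [UU -> d0]]]; have UTU := mulmx1C UU.
exists (\big[Num.min/1]_i d 0 i).
  by apply: (big_ind (fun x => 0 < x)) => // x y x0 y0; rewrite lt_min x0.
move=> x; rewrite orthodiag_bform.
have -> : sqnorm x = \sum_i ((U *m x) i 0) ^+ 2.
  by rewrite -bform1 -UTU bform_mulr -{1}[U^T]mulmx1 bform_mull trmxK bform1.
rewrite mulr_sumr; apply: ler_sum => i _.
by apply: ler_wpM2r; [exact: sqr_ge0 | exact: bigmin_le].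
Qed.

End SpectralTheorem.

(** * Computing spectral functions and the invariant metric *)

Section SpectralFunctions.
Context {R : realType} {n : nat}.
Implicit Types (U P : 'M[R]_n) (d : 'rV[R]_n).

(** If U' diag(d) U = V' diag(e) V then W = U V' intertwines diag(d) and
    diag(e): W_ij vanishes unless d_i = e_j, so W also intertwines diag(f(d))
    and diag(f(e)).  This is why the functional calculus does not depend on the
    diagonalization. *)
Lemma mxfunE (f : R -> R) U d : U *m U^T = 1%:M ->
  mxfun f (U^T *m diag_mx d *m U) = U^T *m diag_mx (map_mx f d) *m U.
Proof.
move=> UU; rewrite /mxfun; case: xgetP => [X _ [V [e [VV PE ->]]]|]; last first.
  move=> /(_ (U^T *m diag_mx (map_mx f d) *m U)) /=; case.
  by exists U, d.
have UTU := mulmx1C UU; have VTV := mulmx1C VV.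
pose W := U *m V^T.
have dW : diag_mx d *m W = W *m diag_mx e.
  rewrite /W; transitivity (U *m (U^T *m diag_mx d *m U) *m V^T).
    by rewrite !mulmxA UU mul1mx.
  by rewrite PE -!mulmxA VV mulmx1.
have fW : diag_mx (map_mx f d) *m W = W *m diag_mx (map_mx f e).
  apply/matrixP => i j; move/matrixP/(_ i j): dW.
  rewrite !mul_diag_mx !mul_mx_diag !mxE.
  move: (\sum_k _) => w h.
  have [->|w0] := eqVneq w 0; first by rewrite mulr0 mul0r.
  have -> : d 0 i = e 0 j by apply: (mulfI w0); rewrite mulrC.
  by rewrite mulrC.
transitivity (U^T *m (W *m diag_mx (map_mx f e)) *m V).
  by rewrite /W !mulmxA UTU mul1mx.
by rewrite -fW /W -!mulmxA VTV mulmx1.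
Qed.

Lemma mxfun_diag (f : R -> R) d :
  mxfun f (diag_mx d) = diag_mx (map_mx f d).
Proof.
have := @mxfunE f 1%:M d; rewrite trmx1 !mul1mx !mulmx1; exact.
Qed.

Lemma char_poly_orthodiag U d : U *m U^T = 1%:M ->
  char_poly (U^T *m diag_mx d *m U) = \prod_(i < n) ('X - (d 0 i)%:P).
Proof.
move=> UU; have UTU := mulmx1C UU.
have -> : \prod_(i < n) ('X - (d 0 i)%:P) = char_poly (diag_mx d).
  rewrite char_poly_trig ?diag_mx_is_trig//.
  by apply: eq_bigr => i _; rewrite mxE eqxx mulr1n.
rewrite /char_poly /char_poly_mx.
have -> : 'X%:M - map_mx polyC (U^T *m diag_mx d *m U) =
  map_mx polyC U^T *m ('X%:M - map_mx polyC (diag_mx d)) *m map_mx polyC U.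
  have h : map_mx polyC U^T *m 'X%:M *m map_mx polyC U = 'X%:M.
    by rewrite scalar_mxC -mulmxA -map_mxM UTU (map_mx1 polyC) mulmx1.
  by rewrite mulmxBr mulmxBl h !map_mxM.
rewrite !det_mulmx mulrC mulrA -det_mulmx -map_mxM UU (map_mx1 polyC).
by rewrite det1 mul1r.
Qed.

(** A split polynomial determines its roots up to order; sorting shows that a
    nonincreasing list exists, so that [eigenvals] does not take its default
    value. *)
Lemma eigenvals_orthodiag U d : U *m U^T = 1%:M ->
  exists s : 'S_n, eigenvals (U^T *m diag_mx d *m U) = \row_i d 0 (s i).
Proof.
move=> UU; rewrite /eigenvals.
pose t : n.-tuple R := [tuple d 0 i | i < n].
pose t' := sort_tuple (fun x y : R => y <= x) t.
have pt : perm_eq t' t by rewrite perm_sort.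
case: xgetP => [l _ [ch _]|].
  have : perm_eq [tuple l 0 i | i < n] t.
    apply: prod_XsubC_eq; rewrite !big_tuple.
    under eq_bigr do rewrite tnth_mktuple.
    under [RHS]eq_bigr do rewrite tnth_mktuple.
    by rewrite -ch char_poly_orthodiag.
  move=> /tuple_permP[s ls]; exists s; apply/rowP => i; rewrite mxE.
  have /(congr1 (fun z : n.-tuple R => tnth z i)) := val_inj ls.
  by rewrite !tnth_mktuple.
move=> /(_ (\row_i tnth t' i)); case; split.
  rewrite char_poly_orthodiag//.
  transitivity (\prod_(x <- t) ('X - x%:P)).
    by rewrite big_tuple; apply: eq_bigr => i _; rewrite tnth_mktuple.
  rewrite -(perm_big _ pt) big_tuple; apply: eq_bigr => i _.
  by rewrite mxE.
move=> i j ij; rewrite !mxE !(tnth_nth 0).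
have st : sorted (fun x y : R => y <= x) t'.
  by apply: sort_sorted => x y; rewrite orbC; exact: le_total.
apply: (sorted_leq_nth _ _ 0 st) => //; rewrite ?inE ?size_tuple//.
by move=> y x z xy /le_trans; exact.
Qed.

Lemma spectral_fun_orthodiag (nu : 'rV[R]_n -> R) U d :
  (forall (s : 'S_n) (l : 'rV[R]_n), nu (\row_i l 0 (s i)) = nu l) ->
  U *m U^T = 1%:M -> spectral_fun nu (U^T *m diag_mx d *m U) = nu d.
Proof.
by move=> nuP /eigenvals_orthodiag-/(_ d)[s]; rewrite /spectral_fun => ->.
Qed.

(** If S is the square root of P and S^-1 Q S^-1 = V' diag(mu) V, then G = V S
    works, and the distance is read off the same diagonalization. *)
Lemma simultaneous_diag (P Q : 'M[R]_n) : pdmx P -> pdmx Q ->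
  exists (G : 'M[R]_n) (mu : 'rV[R]_n),
  [/\ G \in unitmx, forall i, 0 < mu 0 i, P = G^T *m G,
     Q = G^T *m diag_mx mu *m G &
     forall nu : 'rV[R]_n -> R,
     (forall (s : 'S_n) (l : 'rV[R]_n), nu (\row_i l 0 (s i)) = nu l) ->
     gauge_dist nu P Q = nu (map_mx (@ln R) mu)].
Proof.
move=> pdP pdQ; have [U [d [UU PE d0]]] := pd_spectral pdP.
set S := sqrtmx P; have SE : S = U^T *m diag_mx (map_mx Num.sqrt d) *m U.
  by rewrite /S /sqrtmx PE mxfunE.
have SS : S *m S = P.
  rewrite PE SE; set D := diag_mx (map_mx _ d).
  transitivity (U^T *m D *m (U *m U^T) *m D *m U); first by rewrite !mulmxA.
  rewrite UU mulmx1 -[U^T *m D *m D]mulmxA mulmx_diag.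
  congr (_ *m diag_mx _ *m _).
  by apply/rowP => i; rewrite !mxE -expr2 sqr_sqrtr// ltW.
have sS : S^T = S by rewrite SE !trmx_mul trmxK tr_diag_mx mulmxA.
have uS : S \in unitmx.
  by have := pd_unit pdP; rewrite -SS unitmx_mul => /andP[].
set N := invmx S *m Q *m invmx S.
have sN : (invmx S)^T = invmx S by rewrite trmx_inv sS.
have pdN : pdmx N.
  split; first by rewrite /symmx /N !trmx_mul sN pdQ.1 mulmxA.
  move=> x x0; have := pd_bform pdQ (x := invmx S *m x).
  rewrite /bform trmx_mul sN !mulmxA; apply.
  apply: contra_neq x0 => /(congr1 (mulmx S)).
  by rewrite mulmxA mulmxV// mul1mx mulmx0.
have [V [mu [VV NE mu0]]] := pd_spectral pdN.
have VTV := mulmx1C VV.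
exists (V *m S), mu; split => //.
- rewrite unitmx_mul uS andbT -row_free_unit; apply/row_freeP.
  by exists V^T.
- by rewrite trmx_mul sS -mulmxA [V^T *m _]mulmxA VTV mul1mx SS.
- rewrite trmx_mul sS.
  have -> : S *m V^T *m diag_mx mu *m (V *m S) = S *m N *m S.
    by rewrite NE !mulmxA.
  by rewrite /N !mulmxA mulmxV// mul1mx -mulmxA mulVmx// mulmx1.
- move=> nu nuP; rewrite /gauge_dist -/S -/N NE /logmx mxfunE//.
  by rewrite spectral_fun_orthodiag.
Qed.

Lemma gauge_dist_diag (nu : 'rV[R]_n -> R) (p q : 'rV[R]_n) :
  (forall (s : 'S_n) (l : 'rV[R]_n), nu (\row_i l 0 (s i)) = nu l) ->
  (forall i, 0 < p 0 i) ->
  gauge_dist nu (diag_mx p) (diag_mx q) = nu (\row_i ln (q 0 i / p 0 i)).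
Proof.
move=> nuP p0; rewrite /gauge_dist /sqrtmx mxfun_diag.
set S := diag_mx _.
pose T : 'M[R]_n := diag_mx (map_mx (fun x => (Num.sqrt x)^-1) p).
have ST : S *m T = 1%:M.
  rewrite /S /T mulmx_diag -diag_const_mx; congr diag_mx; apply/rowP => i.
  by rewrite !mxE divff// gt_eqF// sqrtr_gt0.
have uS : S \in unitmx by rewrite -row_free_unit; apply/row_freeP; exists T.
have -> : invmx S = T by rewrite -[LHS]mulmx1 -ST mulKmx.
rewrite /T !mulmx_diag /logmx mxfun_diag.
have := @spectral_fun_orthodiag nu 1%:M _ nuP; rewrite trmx1 mulmx1 => h.
rewrite -[diag_mx _]mul1mx -[_ *m diag_mx _]mulmx1 h//; congr nu.
apply/rowP => i; rewrite !mxE; congr ln.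
have sp : 0 < Num.sqrt (p 0 i) by rewrite sqrtr_gt0.
by rewrite -[in RHS](sqr_sqrtr (ltW (p0 i))); field; rewrite gt_eqF.
Qed.

End SpectralFunctions.

(** * The sup-norm metric and the Loewner order *)

Section Thompson.
Context {R : realType} {n : nat}.

Lemma sup_norm_perm (s : 'S_n) (l : 'rV[R]_n) :
  sup_norm (\row_i l 0 (s i)) = sup_norm l.
Proof.
rewrite /sup_norm [RHS](reindex_inj (@perm_inj _ s)) /=.
by apply: eq_bigr => i _; rewrite mxE.
Qed.

Lemma sup_norm_le (l : 'rV[R]_n) s : 0 <= s ->
  sup_norm l <= s <-> forall i, `|l 0 i| <= s.
Proof.
move=> s0; split=> [ls i|h]; last by apply: bigmax_le.
by apply: le_trans ls; apply: le_bigmax.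
Qed.

(** In the coordinates G x the two forms are sums of squares with weights 1 and
    mu_i, so the two order relations mean e^-s <= mu_i <= e^s for every i. *)
Lemma thompsonP (P Q : 'M[R]_n) (s : R) : 0 <= s -> pdmx P -> pdmx Q ->
  gauge_dist sup_norm P Q <= s <->
  forall x, bform Q x x <= expR s * bform P x x /\
            bform P x x <= expR s * bform Q x x.
Proof.
move=> s0 pdP pdQ; have [G [mu [uG mu0 PE QE dE]]] := simultaneous_diag pdP pdQ.
rewrite dE; last exact: sup_norm_perm.
rewrite sup_norm_le//.
have bP x : bform P x x = \sum_i ((G *m x) i 0) ^+ 2.
  by rewrite PE bform_mulr -{1}[G^T]mulmx1 bform_mull trmxK bform1.
have bQ x : bform Q x x = \sum_i mu 0 i * ((G *m x) i 0) ^+ 2.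
  by rewrite QE orthodiag_bform.
have lnE i : `|(map_mx (@ln R) mu) 0 i| <= s <->
    mu 0 i <= expR s /\ 1 <= expR s * mu 0 i.
  have -> : (mu 0 i <= expR s) = (ln (mu 0 i) <= s).
    by rewrite -[RHS]ler_expR lnK ?posrE.
  have -> : (1 <= expR s * mu 0 i) = (- s <= ln (mu 0 i)).
    rewrite -[RHS]ler_expR lnK ?posrE// expRN -[X in _ = (X <= _)]mul1r.
    by rewrite ler_pdivrMr ?expR_gt0// mulrC.
  by rewrite mxE ler_norml; split => [/andP[]|[-> ->]].
split => [h x|h i].
  rewrite bP bQ !mulr_sumr; split; apply: ler_sum => i _;
    have [h1 h2] := (lnE i).1 (h i).
    by apply: ler_wpM2r => //; apply: sqr_ge0.
  by rewrite mulrA ler_peMl// sqr_ge0.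
apply/lnE; have := h (invmx G *m delta_mx i 0).
rewrite bP bQ mulKVmx//.
rewrite (bigD1 i)//= big1 ?addr0; last first.
  by move=> j ji; rewrite mxE (negbTE ji) expr0n mulr0.
rewrite (bigD1 i)//= big1 ?addr0; last first.
  by move=> j ji; rewrite mxE (negbTE ji) expr0n.
by rewrite !mxE !eqxx expr1n !mulr1.
Qed.

End Thompson.

(** * Curves that cannot leave the positive definite cone *)

Section FirstExit.
Context {R : realType} {n : nat}.

Lemma is_derive_entry (Z : R -> 'M[R]_n) (Z' : 'M[R]_n) (s : R) i j :
  is_derive s (1 : R) Z Z' -> is_derive s (1 : R) (fun u => Z u i j) (Z' i j).
Proof.
move=> [dZ <-]; have dZij := (derivable_mxP Z s 1).1 dZ i j.
by apply: DeriveDef => //; rewrite derive_mx// mxE.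
Qed.

Lemma is_derive_bform (Z : R -> 'M[R]_n) (Z' : 'M[R]_n) (s : R) x y :
  (forall i j, is_derive s (1 : R) (fun u => Z u i j) (Z' i j)) ->
  is_derive s (1 : R) (fun u => bform (Z u) x y) (bform Z' x y).
Proof.
move=> dZ; rewrite bformE.
have -> : (fun u => bform (Z u) x y) =
   \sum_i \sum_j ((x i 0 * y j 0) \*: (fun u => Z u i j)).
  apply/funext => u; rewrite fct_sumE bformE; apply: eq_bigr => i _.
  by rewrite fct_sumE; apply: eq_bigr => j _; rewrite mulrAC.
apply: is_derive_sum => i; apply: is_derive_sum => j.
rewrite mulrAC.
exact: (is_deriveZ _ (dZ i j)).
Qed.

Lemma is_derive_continuous (f : R -> R) (s a : R) :
  is_derive s (1 : R) f a -> {for s, continuous f}.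
Proof.
by move=> [df _]; apply: differentiable_continuous; apply/derivable1_diffP.
Qed.

Lemma derive_pos_left (f : R -> R) (s a : R) :
  is_derive s (1 : R) f a -> 0 < a -> f s = 0 ->
  exists2 d, 0 < d & forall u, s - d < u -> u < s -> f u < 0.
Proof.
move=> /is_derive1_caratheodory[g [fg cg gs]] a0 fs0.
have : \forall u \near s, 0 < g u by apply: (cvgr_gt _ cg); rewrite gs.
move=> /nbhs_ballP[d /= d0 gd]; exists d => // u sdu us.
have := fg u; rewrite fs0 subr0 => ->; rewrite pmulr_rlt0 ?subr_lt0//.
by apply: gd; rewrite /ball/= gtr0_norm ?subr_gt0// ltrBlDr addrC -ltrBlDr.
Qed.

Lemma bform_small (D : 'M[R]_n) (e : R) (x : 'cV[R]_n) :
  (forall i j, `|D i j| <= e) -> `|bform D x x| <= e * n%:R * sqnorm x.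
Proof.
move=> De; rewrite bformE.
apply: le_trans (_ : \sum_i \sum_j e * ((x i 0 ^+ 2 + x j 0 ^+ 2) / 2) <= _).
  apply: le_trans (ler_norm_sum _ _ _) _; apply: ler_sum => i _.
  apply: le_trans (ler_norm_sum _ _ _) _; apply: ler_sum => j _.
  rewrite mulrAC normrM mulrC; apply: ler_pM => //.
  rewrite normrM -(real_normK (num_real (x i 0))).
  rewrite -(real_normK (num_real (x j 0))).
  have := sqr_ge0 (`|x i 0| - `|x j 0|); nra.
rewrite le_eqVlt; apply/orP; left; apply/eqP.
have -> : \sum_i \sum_j e * ((x i 0 ^+ 2 + x j 0 ^+ 2) / 2) =
    e / 2 * (\sum_(i < n) \sum_(j < n) x i 0 ^+ 2 + \sum_(i < n) sqnorm x).
  rewrite -big_split mulr_sumr; apply: eq_bigr => i _.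
  by rewrite -big_split mulr_sumr; apply: eq_bigr => j _ /=; field.
under eq_bigr do rewrite sumr_const card_ord.
rewrite sumrMnl sumr_const card_ord -/(sqnorm x) -[sqnorm x *+ n]mulr_natr. 
  by field.
Qed.

(** Positive definiteness is an open condition, with a neighbourhood uniform in
    x: P dominates c |x|^2, and a perturbation with entries at most c/(n+1)
    changes the form by less than c |x|^2. *)
Lemma pd_near (Z : R -> 'M[R]_n) (s : R) :
  (forall i j, {for s, continuous (fun u => Z u i j)}) -> pdmx (Z s) ->
  \forall u \near s, forall x, x != 0 -> 0 < bform (Z u) x x.
Proof.
move=> cZ /pd_coercive[c c0 cP].
pose e := c / n.+1%:R; have e0 : 0 < e by rewrite divr_gt0.
have nearZ : \forall u \near s, forall ij : 'I_n * 'I_n,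
    `|Z s ij.1 ij.2 - Z u ij.1 ij.2| <= e.
  apply: (filter_forall (nbhs_filter s)) => ij.
  exact: ((cvgrPdist_le _ _).1 (cZ ij.1 ij.2) _ e0).
near=> u => x x0.
have Zu' : forall ij : 'I_n * 'I_n, `|Z s ij.1 ij.2 - Z u ij.1 ij.2| <= e.
  by near: u; exact: nearZ.
have Zu i j : `|(Z s - Z u) i j| <= e by rewrite !mxE; exact: (Zu' (i, j)).
have := bform_small x Zu; rewrite bformD bformN => /ler_normlW h.
have := cP x; have nx : 0 < sqnorm x by rewrite sqnorm_gt0.
have en : e * n%:R * sqnorm x < c * sqnorm x.
  rewrite ltr_pM2r// /e mulrAC ltr_pdivrMr// ltr_pM2l// ltr_nat//.
by lra.
Unshelve. all: by end_near. Qed.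

(** Barrier principle.  Let T be the supremum of the times up to which Z stays
    positive definite.  By continuity Z(T) is positive semi-definite; were it
    singular, a kernel vector x would give a function x' Z x vanishing at T with
    positive derivative, hence negative just before T.  So Z(T) is positive
    definite, and by openness T < t would contradict the choice of T. *)
Lemma first_exit (Z Z' : R -> 'M[R]_n) (t : R) : 0 <= t ->
  (forall s, 0 <= s <= t -> symmx (Z s)) ->
  (forall s, 0 <= s <= t -> forall i j,
     is_derive s (1 : R) (fun u => Z u i j) (Z' s i j)) ->
  pdmx (Z 0) ->
  (forall s, 0 <= s <= t -> psdmx (Z s) ->
     forall x, x != 0 -> Z s *m x = 0 -> 0 < bform (Z' s) x x) ->
  pdmx (Z t).
Proof.
move=> t0 sZ dZ pd0 inward.
pose E : set R :=
  [set s | 0 <= s <= t /\ forall u, 0 <= u <= s -> pdmx (Z u)]%classic.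
have E0 : E 0.
  split; first by rewrite lexx.
  by move=> u; rewrite -eq_le => /eqP <-.
have ubE : ubound E t by move=> s [/andP[]].
have supE : has_sup E by split; [exists 0 | exists t].
pose T := sup E.
have T0 : 0 <= T by apply: ub_le_sup => //; exact: supE.2.
have Tt : T <= t by apply: ge_sup => //; exists 0.
have T0t : 0 <= T <= t by rewrite T0.
have before u : 0 <= u -> u < T -> pdmx (Z u).
  move=> u0 uT; have : 0 < T - u by rewrite subr_gt0.
  move=> /(sup_adherent)/(_ supE)[s [_ Es]]; rewrite opprB addrC subrK => us.
  by apply: Es; rewrite u0 ltW.
have dT x := is_derive_bform x x (dZ T T0t).
have posbefore x u : x != 0 -> 0 <= u -> u < T -> 0 < bform (Z u) x x.
  by move=> x0 u0 uT; apply: pd_bform => //; apply: before.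
have left_witness d : 0 < T -> 0 < d ->
    exists u, [/\ 0 <= u, T - d < u & u < T].
  move=> T_gt0 d0; exists (Num.max 0 (T - d / 2)); split.
  - by rewrite le_max lexx.
  - by rewrite lt_max; apply/orP; right; lra.
  - by rewrite gt_max T_gt0; lra.
have psdT : psdmx (Z T).
  split; first exact: sZ.
  move=> x; have [->|x0] := eqVneq x 0; first by rewrite mulmx0 mxE.
  rewrite leNgt; apply/negP => neg.
  have [T_eq0|T_neq0] := eqVneq T 0.
    by move: neg; rewrite T_eq0 ltNge (ltW (pd_bform pd0 x0)).
  have T_gt0 : 0 < T by rewrite lt_def T_neq0.
  have : \forall u \near T, bform (Z u) x x < 0.
    exact: (cvgr_lt _ (is_derive_continuous (dT x))).
  move=> /nbhs_ballP[d /= d0 hd].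
  have [u [u0 du uT]] := left_witness _ T_gt0 d0.
  have := hd u; rewrite /ball/= gtr0_norm ?subr_gt0// ltrBlDr addrC -ltrBlDr.
  by move=> /(_ du); rewrite ltNge (ltW (posbefore _ _ x0 u0 uT)).
have pdT : pdmx (Z T).
  apply: contrapT => npd; have [x x0 Zx] := psd_not_pd psdT npd.
  have T_gt0 : 0 < T.
    rewrite lt_def T0 andbT; apply/eqP => T_eq0.
    by apply: npd; rewrite T_eq0.
  have fT : bform (Z T) x x = 0 by rewrite /bform -mulmxA Zx mulmx0 mxE.
  have [d d0 hd] := derive_pos_left (dT x) (inward _ T0t psdT _ x0 Zx) fT.
  have [u [u0 du uT]] := left_witness _ T_gt0 d0.
  by have := hd u du uT; rewrite ltNge (ltW (posbefore _ _ x0 u0 uT)).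
move: Tt; rewrite le_eqVlt => /orP[/eqP<-//|Tt].
have /nbhs_ballP[d /= d0 hd] :=
  pd_near (fun i j => is_derive_continuous (dZ T T0t i j)) pdT.
pose s := Num.min t (T + d / 2).
have Ts : T < s by rewrite lt_min Tt; lra.
have st : s <= t by rewrite ge_min lexx.
have sd : s <= T + d / 2 by rewrite ge_min lexx orbT.
have Es : E s.
  split; first by rewrite st (le_trans T0 (ltW Ts)).
  move=> u /andP[u0 us]; have [uT|Tu] := ltP u T; first exact: before.
  split; first by apply: sZ; rewrite u0 (le_trans us).
  apply: hd; rewrite /ball/= ler0_norm ?subr_le0//; lra.
have : s <= T by apply: ub_le_sup => //; exact: supE.2.
by rewrite leNgt Ts.
Qed.

End FirstExit.

(** * The Riccati operator as a minimum over controls *)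

Section RiccatiForm.
Context {R : realType} {n k : nat}.
Variable p : riccati_param R n k.
Hypothesis adm : admissible p.

(** A kernel vector of R + D' P D is isotropic both for R and for D' P D, so it
    lies in the intersection of the kernels of R and D. *)
Lemma riccati_gain_pd (P : 'M[R]_n) : pdmx P ->
  pdmx (rR p + (rD p)^T *m P *m rD p).
Proof.
case: adm => sQ sR psdW kerRD pdP.
have psdR : psdmx (rR p).
  split => // u; have := psdW.2 (col_mx 0 u).
  rewrite tr_col_mx mul_row_block mul_row_col trmx0 !mul0mx mulmx0 !add0r.
  by [].
have DE u : bform ((rD p)^T *m P *m rD p) u u = bform P (rD p *m u) (rD p *m u).
  by rewrite bform_mulr bform_mull trmxK.
split.
  by rewrite /symmx linearD /= !trmx_mul trmxK sR pdP.1 mulmxA.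
move=> u u0; change (0 < bform (rR p + (rD p)^T *m P *m rD p) u u).
rewrite bformD DE.
have R0 := psd_bform psdR u; have D0 := psd_bform (pd_psd pdP) (rD p *m u).
rewrite lt_def addr_ge0// andbT; apply: contra_neq u0 => h.
have Ru : bform (rR p) u u = 0 by apply/eqP; lra.
have Du : bform P (rD p *m u) (rD p *m u) = 0 by lra.
apply: kerRD; first exact: psd_ker.
by apply/eqP; apply: contraT => /(pd_bform pdP); rewrite Du ltxx.
Qed.

(** The part linear in P of the form minimized over u: the value at x of
    (A + B K)' P + P (A + B K) + (C + D K)' P (C + D K) when u = K x. *)
Definition controlled_form (P : 'M[R]_n) (x : 'cV[R]_n) (u : 'cV[R]_k) : R :=
  2 * bform P x (rA p *m x + rB p *m u)
  + bform P (rC p *m x + rD p *m u) (rC p *m x + rD p *m u).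

Definition cost_form (x : 'cV[R]_n) (u : 'cV[R]_k) : R :=
  bform (block_mx (rQ p) (rL p)^T (rL p) (rR p)) (col_mx x u) (col_mx x u).

Lemma cost_form_ge0 x u : 0 <= cost_form x u.
Proof. by case: adm => _ _ psdW _; apply: psd_bform. Qed.

(** Completing the square in u: the sum of the two forms is a quadratic function
    of u with leading part u' S u and minimizer - S^-1 y, its minimum is the
    Riccati form, and v is the deviation from the minimizer. *)
Lemma riccati_form_split (P : 'M[R]_n) x v : pdmx P ->
  let S := rR p + (rD p)^T *m P *m rD p in
  let y := ((rB p)^T *m P + (rD p)^T *m P *m rC p + rL p) *m x in
  controlled_form P x (v - invmx S *m y) + cost_form x (v - invmx S *m y) =
  bform (riccati p P) x x + bform S v v.
Proof.
move=> pdP S y; have pdS : pdmx S := riccati_gain_pd pdP.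
have uS := pd_unit pdS; have sS := pdS.1; have sP := pdP.1.
set u := v - _.
have vE : v = u + invmx S *m y by rewrite /u subrK.
clearbody u.
have -> : bform S v v = bform S u u + 2 * bform 1%:M u y + bform (invmx S) y y.
  rewrite vE !bformDl !bformDr (bform_sym (invmx S *m y) u)//.
  rewrite -!(bform_mulr S (invmx S)) mulmxV//.
  have -> : bform 1%:M (invmx S *m y) y = bform (invmx S) y y.
    by rewrite -{1}(symmx_inv sS) -bform_mull mulmx1.
  by ring.
have -> : bform (riccati p P) x x = 2 * bform P x (rA p *m x)
    + bform P (rC p *m x) (rC p *m x) + bform (rQ p) x x - bform (invmx S) y y.
  rewrite /riccati -/S !bformD bformN.
  rewrite [bform (_ *m (_ + _)) x x]bform_mulr -/y.
  rewrite [bform (_ *m rC p) x x]bform_mulr [bform (P *m _) x x]bform_mulr.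
  rewrite !bform_mull !trmxK -/y.
  rewrite (bform_sym (rA p *m x) x)//; ring.
have -> : bform 1%:M u y = bform P x (rB p *m u)
    + bform P (rC p *m x) (rD p *m u) + bform (rL p) u x.
  rewrite /y -bform_mulr mul1mx !bformD [bform (_ *m rC p) _ _]bform_mulr.
  rewrite !bform_mull !trmxK.
  by rewrite (bform_sym x _ sP) (bform_sym (rC p *m x) _ sP).
have -> : cost_form x u =
    bform (rQ p) x x + 2 * bform (rL p) u x + bform (rR p) u u.
  by rewrite /cost_form bform_block bform_tr; ring.
rewrite /controlled_form /S bformD [bform (_ *m rD p) u u]bform_mulr.
rewrite bform_mull trmxK.
rewrite !bformDl !bformDr (bform_sym (rD p *m u) (rC p *m x))//.
by ring.
Qed.

Lemma riccati_form_le (P : 'M[R]_n) x u : pdmx P ->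
  bform (riccati p P) x x <= controlled_form P x u + cost_form x u.
Proof.
move=> pdP; set S := rR p + (rD p)^T *m P *m rD p.
set y := ((rB p)^T *m P + (rD p)^T *m P *m rC p + rL p) *m x.
have := riccati_form_split x (u + invmx S *m y) pdP.
rewrite /= -/S -/y addrK => ->; rewrite lerDl.
by apply/psd_bform/pd_psd/riccati_gain_pd.
Qed.

Lemma riccati_form_attained (P : 'M[R]_n) x : pdmx P ->
  exists u, bform (riccati p P) x x = controlled_form P x u + cost_form x u.
Proof.
move=> pdP; have := riccati_form_split x 0 pdP.
by rewrite /= bform0 addr0 => <-; eexists.
Qed.

(** Replacing lam by c(s) = lam + e (1 + s) makes both the initial inequality
    and the differential inequality for Z = c X1 - X2 strict.  At a kernel
    vector z of a positive semi-definite Z, take the control u that is optimal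
    for X1: the controlled form of Z is then at least its cross term, which
    vanishes with Z z, the cost contributes (c - 1) times a non-negative number,
    and the derivative of c contributes e z' X1 z > 0. *)
Lemma riccati_comparison (X1 X2 : R -> 'M[R]_n) (t lam : R) :
  0 <= t -> 1 <= lam ->
  (forall s, 0 <= s <= t ->
     pdmx (X1 s) /\ is_derive s (1 : R) X1 (riccati p (X1 s))) ->
  (forall s, 0 <= s <= t ->
     pdmx (X2 s) /\ is_derive s (1 : R) X2 (riccati p (X2 s))) ->
  (forall x, bform (X2 0) x x <= lam * bform (X1 0) x x) ->
  forall x, bform (X2 t) x x <= lam * bform (X1 t) x x.
Proof.
move=> t0 lam1 sol1 sol2 init x.
have [->|x0] := eqVneq x 0; first by rewrite !bform0 mulr0.
have tt : 0 <= t <= t by rewrite t0 lexx.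
have [pd1t _] := sol1 t tt.
have X1x : 0 < bform (X1 t) x x by apply: pd_bform.
suff perturbed e : 0 < e ->
    0 < (lam + e * (1 + t)) * bform (X1 t) x x - bform (X2 t) x x.
  apply/ler_addgt0Pr => d d0.
  (* This makes the perturbation at time t equal to d. *)
  have e0 : 0 < d / ((1 + t) * bform (X1 t) x x).
    by rewrite divr_gt0// mulr_gt0//; lra.
  have := perturbed _ e0.
  have -> : (lam + d / ((1 + t) * bform (X1 t) x x) * (1 + t))
      * bform (X1 t) x x = lam * bform (X1 t) x x + d.
    field; rewrite !gt_eqF//; lra.
  by lra.
move=> e0.
pose c (s : R) := lam + e * (1 + s).
pose Z (s : R) : 'M[R]_n := c s *: X1 s - X2 s.
pose Z' (s : R) : 'M[R]_n :=
  e *: X1 s + c s *: riccati p (X1 s) - riccati p (X2 s).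
have bZ s y z : bform (Z s) y z = c s * bform (X1 s) y z - bform (X2 s) y z.
  by rewrite /Z bformD bformN bformZ.
suff pdZ : pdmx (Z t) by have := pd_bform pdZ x0; rewrite bZ.
have tt0 : 0 <= (0 : R) <= t by rewrite lexx.
have sZ s : 0 <= s <= t -> symmx (Z s).
  move=> st; have [[s1 _] _] := sol1 s st; have [[s2 _] _] := sol2 s st.
  by rewrite /symmx /Z linearB linearZ /= s1 s2.
apply: (@first_exit _ _ Z Z') => //.
- move=> s st i j; have [_ /is_derive_entry-/(_ i j) d1] := sol1 s st.
  have [_ /is_derive_entry-/(_ i j) d2] := sol2 s st.
  have -> : (fun u => Z u i j) = c * (fun u => X1 u i j) - (fun u => X2 u i j).
    by apply/funext => u; rewrite /Z !mxE.
  have dc : is_derive s (1 : R) c e.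
    rewrite /c; apply: is_derive_eq; rewrite /GRing.scale /=; ring.
  apply: is_derive_eq; rewrite !mxE /GRing.scale /=; ring.
- have [pd1 _] := sol1 0 tt0; have [pd2 _] := sol2 0 tt0.
  split; first exact: sZ.
  move=> y y0; change (0 < bform (Z 0) y y); rewrite bZ /c.
  by have := init y; have := mulr_gt0 e0 (pd_bform pd1 y0); lra.
- move=> s st psdZ z z0 Zz.
  have [pd1 _] := sol1 s st; have [pd2 _] := sol2 s st.
  have [u ru] := riccati_form_attained z pd1.
  have le2 := riccati_form_le z u pd2.
  have X1z := pd_bform pd1 z0.
  have q0 := cost_form_ge0 z u.
  have c1 : 1 <= c s.
    rewrite /c; case/andP: st => s0 _.
    have : 0 <= e * (1 + s) by rewrite mulr_ge0 ?(ltW e0)//; lra.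
    by lra.
  have Zw w : bform (Z s) z w = 0.
    rewrite bform_sym; last exact: psdZ.1.
    by rewrite /bform -mulmxA Zz mulmx0 mxE.
  have ctrl :
      0 <= c s * controlled_form (X1 s) z u - controlled_form (X2 s) z u.
    have := Zw (rA p *m z + rB p *m u).
    have := psd_bform psdZ (rC p *m z + rD p *m u).
    rewrite !bZ /controlled_form; lra.
  rewrite /Z' !bformD bformN !bformZ ru.
  have : 0 <= (c s - 1) * cost_form z u by rewrite mulr_ge0// subr_ge0.
  have : 0 < e * bform (X1 s) z z by rewrite mulr_gt0.
  by lra.
Qed.

End RiccatiForm.

(** * Non-expansiveness in the sup-norm metric *)

Section SupNormNonexpansive.
Context {R : realType} {n k : nat}.
Variable p : riccati_param R n k.

(** The domain of the maximal solution is an interval, so it contains [0, t]. *)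
Lemma riccati_flow_solution t P Y : 0 <= t -> riccati_flow p t P Y ->
  exists X : R -> 'M[R]_n, [/\ X 0 = P, X t = Y & forall s, 0 <= s <= t ->
    pdmx (X s) /\ is_derive s (1 : R) X (riccati p (X s))].
Proof.
move=> t0 [J [X [[[oJ iJ J0 sol] _] X0 Jt Xt]]].
by exists X; split => // s st; apply: sol; apply: (iJ 0 t).
Qed.

Lemma sup_norm_nonexpansive : admissible p -> nonexpansive_flow p sup_norm.
Proof.
move=> adm P1 P2 pd1 pd2 t t0 Y1 Y2.
move=> /(riccati_flow_solution t0)[X1 [X10 X1t sol1]].
move=> /(riccati_flow_solution t0)[X2 [X20 X2t sol2]].
have tt : 0 <= t <= t by rewrite t0 lexx.
set s := gauge_dist sup_norm P1 P2.
have s0 : 0 <= s by apply: bigmax_ge_id.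
have h := (thompsonP s0 pd1 pd2).1 (lexx _).
have es : 1 <= expR s by rewrite -expR0 ler_expR.
apply/thompsonP => //.
- by rewrite -X1t; have [] := sol1 t tt.
- by rewrite -X2t; have [] := sol2 t tt.
rewrite -X1t -X2t => x; split.
- apply: (riccati_comparison adm t0 es sol1 sol2) => y.
  by rewrite X10 X20; have [] := h y.
- apply: (riccati_comparison adm t0 es sol2 sol1) => y.
  by rewrite X10 X20; have [] := h y.
Qed.

End SupNormNonexpansive.

(** * Monotonicity of symmetric gauge functions *)

Section SymmetricGauge.
Context {R : realType} {n : nat}.
Variable nu : 'rV[R]_n -> R.
Hypothesis hnu : symmetric_gauge nu.

Lemma gauge_scale a l : 0 < a -> nu (a *: l) = a * nu l.
Proof. by case: hnu => _ + _; exact. Qed.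

Lemma gauge_perm (s : 'S_n) (l : 'rV[R]_n) : nu (\row_i l 0 (s i)) = nu l.
Proof.
case: hnu => _ _ h; rewrite (h 1%g (\row_i _)) (h s l).
by congr nu; apply/rowP => i; rewrite !mxE perm1.
Qed.

Lemma gauge_abs (u v : 'rV[R]_n) : (forall i, `|u 0 i| = `|v 0 i|) ->
  nu u = nu v.
Proof.
move=> uv; case: hnu => _ _ h; rewrite (h 1%g u) (h 1%g v).
by congr nu; apply/rowP => i; rewrite !mxE uv.
Qed.

Lemma gauge0 : nu 0 = 0.
Proof.
by have := @gauge_scale 2 0 (ltr0Sn _ 1); rewrite scaler0 => h; lra.
Qed.

Lemma gauge_convex t (u v : 'rV[R]_n) : 0 <= t -> t <= 1 ->
  nu (t *: u + (1 - t) *: v) <= t * nu u + (1 - t) * nu v.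
Proof.
move=> t0 t1; case: hnu => cv _ _.
pose T := Itv01 t0 t1.
have convE : conv T (u : convex_lmodType 'rV[R]_n) v = t *: u + (1 - t) *: v.
  by [].
have := cv T u v (in_setT _) (in_setT _).
by rewrite convRE convE.
Qed.

(** The shrunk vector is a convex combination of v and of v with its j-th sign
    flipped, at which nu takes the same value. *)
Lemma gauge_shrink_coord (j : 'I_n) t (v : 'rV[R]_n) : `|t| <= 1 ->
  nu (\row_i (if i == j then t * v 0 i else v 0 i)) <= nu v.
Proof.
rewrite ler_norml => /andP[t1 t2].
pose w : 'rV[R]_n := \row_i (if i == j then - v 0 i else v 0 i).
have wv : nu w = nu v.
  by apply: gauge_abs => i; rewrite mxE; case: eqP => // _; rewrite normrN.
have -> : \row_i (if i == j then t * v 0 i else v 0 i) =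
    ((1 + t) / 2) *: v + (1 - (1 + t) / 2) *: w.
  by apply/rowP => i; rewrite !mxE; case: eqP => _; field.
apply: le_trans (gauge_convex _ _ _ _) _; [lra|lra|].
by rewrite wv; lra.
Qed.

(** Replace the coordinates of v by those of u one after the other. *)
Lemma gauge_monotone (u v : 'rV[R]_n) : (forall i, `|u 0 i| <= `|v 0 i|) ->
  nu u <= nu v.
Proof.
move=> uv; pose w m : 'rV[R]_n := \row_i (if (i < m)%N then u 0 i else v 0 i).
suff wle m : (m <= n)%N -> nu (w m) <= nu v.
  have -> : u = w n by apply/rowP => i; rewrite mxE ltn_ord.
  exact: wle.
elim: m => [_|m IH mn].
  by rewrite le_eqVlt (_ : w 0%N = v) ?eqxx//; apply/rowP => i; rewrite mxE.
apply: le_trans (IH (ltnW mn)).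
pose j := Ordinal mn.
have [t t1 ut] : exists2 t, `|t| <= 1 & u 0 j = t * v 0 j.
  have [vj0|vj0] := eqVneq (v 0 j) 0.
    exists 0; first by rewrite normr0.
    by have := uv j; rewrite vj0 normr0 normr_le0 mul0r => /eqP.
  exists (u 0 j / v 0 j); last by rewrite divfK.
  by rewrite normrM normfV ler_pdivrMr ?normr_gt0// mul1r.
apply: le_trans (gauge_shrink_coord j (w m) t1).
rewrite le_eqVlt; apply/orP; left; apply/eqP; congr nu; apply/rowP => i.
rewrite !mxE; have [->|ij] := eqVneq i j; first by rewrite /= ltnSn ltnn ut.
by rewrite ltnS leq_eqVlt (_ : (i == m :> nat) = false)//; apply/negbTE.
Qed.

Lemma gauge_ge0 l : 0 <= nu l.
Proof. by rewrite -gauge0; apply: gauge_monotone => i; rewrite mxE normr0. Qed.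

End SymmetricGauge.

(** * Derivatives of matrix curves, and diagonal matrices *)

Section DerivativeTools.
Context {R : realType}.

Lemma is_derive_of_entries n (X : R -> 'M[R]_n) (X' : 'M[R]_n) (s : R) :
  (forall i j, is_derive s (1 : R) (fun u => X u i j) (X' i j)) ->
  is_derive s (1 : R) X X'.
Proof.
move=> h; have dX : derivable X s 1.
  by apply/derivable_mxP => i j; have [] := h i j.
apply: DeriveDef => //; rewrite derive_mx//; apply/matrixP => i j.
by rewrite mxE; have [_ ->] := h i j.
Qed.

Lemma derive0_cst (J : set R) (f : R -> R) (a b : R) :
  is_interval J -> J a -> J b ->
  (forall s, J s -> is_derive s (1 : R) f 0) -> f a = f b.
Proof.
move=> iJ; wlog ab : a b / a <= b.
  move=> H Ja Jb df; have [ab|/ltW ba] := leP a b; first exact: H.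
  by apply/esym/H.
move=> Ja Jb df.
have dab s : s \in `[a, b] -> is_derive s (1 : R) f 0.
  by rewrite in_itv /= => abs; apply: df; apply: (iJ a b).
have df_oo x : x \in `]a, b[ -> is_derive x (1 : R) f ((cst 0 : R -> R) x).
  by move=> xab; apply: dab; apply: subset_itv_oo_cc xab.
have cf : {within `[a, b], continuous f}%classic.
  apply: derivable_within_continuous => x xab.
  by have [] := dab x xab.
have [c _] := MVT_segment ab df_oo cf.
by rewrite /= mul0r => /eqP; rewrite subr_eq0 => /eqP.
Qed.

Lemma pd_diag n (d : 'rV[R]_n) : (forall i, 0 < d 0 i) -> pdmx (diag_mx d).
Proof.
move=> d0; split; first by rewrite /symmx tr_diag_mx.
move=> x x0; have nx : 0 < sqnorm x by rewrite sqnorm_gt0.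
have -> : (x^T *m diag_mx d *m x) 0 0 = \sum_i d 0 i * x i 0 ^+ 2.
  rewrite mul_mx_diag mxE; apply: eq_bigr => i _; rewrite !mxE; ring.
have ge0 i : 0 <= d 0 i * x i 0 ^+ 2 by rewrite mulr_ge0 ?sqr_ge0// ltW.
rewrite lt_def sumr_ge0 ?andbT//; apply: contra_neq x0 => s0.
apply/colP => i; rewrite mxE.
have /eqP : d 0 i * x i 0 ^+ 2 = 0.
  exact: (psumr_eq0P (fun i _ => ge0 i) s0).
by rewrite mulf_eq0 gt_eqF//= sqrf_eq0 => /eqP.
Qed.

Lemma pd_diag_gt0 n (P : 'M[R]_n) i : pdmx P -> 0 < P i i.
Proof.
move=> pdP; have : 0 < bform P (delta_mx i 0) (delta_mx i 0).
  apply: pd_bform => //; apply/eqP => /colP/(_ i); rewrite !mxE !eqxx => /eqP.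
  by rewrite oner_eq0.
by rewrite /bform trmx_delta -rowE -colE !mxE.
Qed.

End DerivativeTools.

(** * A flow feeding one diagonal entry into another *)

Section FeedFlow.
Context {R : realType} {n : nat}.
Variables i0 j : 'I_n.
Hypothesis i0j : i0 != j.

(** Here C' P C = P_(i0,i0) E_jj, and the remaining terms of the Riccati
    operator vanish. *)
Definition feed_param : riccati_param R n 1 :=
  RiccatiParam 0 0 (delta_mx i0 j) 0 0 0 1%:M.

Lemma feed_admissible : admissible feed_param.
Proof.
split => /=; rewrite /symmx ?trmx0 ?trmx1//.
  split; first by rewrite /symmx tr_block_mx !trmx0 trmx1.
  move=> x; rewrite -[x]vsubmxK.
  change (0 <= bform (block_mx 0 0 0 1%:M) (col_mx (usubmx x) (dsubmx x))
    (col_mx (usubmx x) (dsubmx x))).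
  rewrite bform_block bform1 /bform !mulmx0 !mul0mx !mxE !add0r.
  exact: sqnorm_ge0.
by move=> x; rewrite mul1mx.
Qed.

Lemma feed_riccati (P : 'M[R]_n) :
  riccati feed_param P = P i0 i0 *: delta_mx j j.
Proof.
rewrite /riccati /= !(trmx0, mul0mx, mulmx0, add0r, addr0, subr0).
apply/matrixP => a b; rewrite trmx_delta !mxE (bigD1 i0)//= big1 ?addr0.
  rewrite !mxE eqxx (bigD1 i0)//= big1 ?addr0.
    by rewrite !mxE eqxx andbT /= mulrAC -natrM mulnb mulrC.
  by move=> c ci; rewrite !mxE (negbTE ci) andbF mul0r.
by move=> c ci; rewrite !mxE (negbTE ci) mulr0.
Qed.

(** The affine curve P + s P_(i0,i0) E_jj is a solution while its (j,j) entry is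
    positive.  It is maximal: along any solution that extends it the entry
    (i0,i0) is constant, so the entry (j,j) is the same affine function, and it
    must be positive at every time of existence. *)
Lemma feed_flow (d : 'rV[R]_n) : (forall i, 0 < d 0 i) ->
  riccati_flow feed_param 1 (diag_mx d)
    (diag_mx (\row_i (d 0 i + (i == j)%:R * d 0 i0))).
Proof.
move=> d0.
pose e (s : R) : 'rV[R]_n := \row_i (d 0 i + (i == j)%:R * (s * d 0 i0)).
pose X (s : R) : 'M[R]_n := diag_mx (e s).
pose J : set R := [set s | - (d 0 j / d 0 i0) < s]%classic.
have JE s : J s <-> 0 < d 0 j + s * d 0 i0.
  by rewrite /J /= -mulNr ltr_pdivrMr// -subr_gt0 opprK addrC.
have J0 : J 0 by apply/JE; rewrite mul0r addr0.
have Xi0 s : X s i0 i0 = d 0 i0.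
  by rewrite !mxE eqxx mulr1n (negbTE i0j) mul0r addr0.
have sol : riccati_solution feed_param J X.
  split; [exact: open_gt | | exact: J0 |].
    by move=> x y Jx _ z /andP[xz _]; exact: lt_le_trans Jx xz.
  move=> s Js; split.
    apply: pd_diag => i; rewrite mxE; have [->|_] := eqVneq i j.
      by rewrite mul1r; apply/JE.
    by rewrite mul0r addr0.
  apply: is_derive_of_entries => a b; rewrite feed_riccati Xi0.
  have -> : (fun u => X u a b) = cst (diag_mx d a b)
      + (d 0 i0 * (delta_mx j j : 'M[R]_n) a b) \*: (id : R -> R).
    apply/funext => u; rewrite /X /e !mxE /= fctE /= /GRing.scale /=.
    have [->|ab] := eqVneq a b; last first.
      rewrite !mulr0n add0r.
      have [aj|] := eqVneq a j; last by rewrite mulr0 mul0r.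
      by rewrite -aj [b == a]eq_sym (negbTE ab) mulr0 mul0r.
    by rewrite !mulr1n andbb; ring.
  by apply: is_derive_eq; rewrite !mxE add0r /GRing.scale /= mulr1.
exists J, X; split => //; first split => //.
- move=> J' X' [oJ' iJ' J'0 sol'] JJ' XX' s J's; apply/JE.
  have X'0 : X' 0 = X 0 by apply: XX'.
  have cst_i0 u : J' u -> X' u i0 i0 = d 0 i0.
    move=> J'u; rewrite -(Xi0 0) -X'0.
    apply: (derive0_cst (f := fun v => X' v i0 i0) iJ' J'u J'0) => v J'v.
    have [_ /is_derive_entry-/(_ i0 i0)] := sol' v J'v.
    by rewrite feed_riccati !mxE (negbTE i0j) mulr0.
  pose f := (fun u => X' u j j) - d 0 i0 \*: (id : R -> R).
  have fs : f s = f 0.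
    apply: (derive0_cst iJ' J's J'0) => v J'v.
    have [_ /is_derive_entry-/(_ j j)] := sol' v J'v.
    rewrite feed_riccati cst_i0// !mxE !eqxx mulr1 => dv.
    by apply: is_derive_eq; rewrite /GRing.scale /= mulr1 subrr.
  have [pds _] := sol' s J's; have := pd_diag_gt0 j pds.
  have -> : X' s j j = d 0 j + s * d 0 i0; last by [].
  have : X' s j j - d 0 i0 * s = X' 0 j j - d 0 i0 * 0 by exact: fs.
  rewrite X'0 /X !mxE !eqxx mulr1n mul1r mul0r; lra.
- by congr diag_mx; apply/rowP => i; rewrite mxE mul0r mulr0 addr0.
- by apply/JE; rewrite mul1r addr_gt0.
- by congr diag_mx; apply/rowP => i; rewrite !mxE mul1r.
Qed.

End FeedFlow.

(** * Non-expansiveness forces the sup-norm *)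

Section Necessity.
Context {R : realType} {n : nat}.
Variable nu : 'rV[R]_n -> R.
Hypothesis hnu : symmetric_gauge nu.
Hypothesis nonexp : forall (k : nat) (p : riccati_param R n k),
  (0 < k)%N -> admissible p -> nonexpansive_flow p nu.

Definition initial_ones m : 'rV[R]_n := \row_(i < n) (i < m)%:R.

(** Feed from coordinate 0 into coordinate m two diagonal matrices with ratio e
    in the first m coordinates and equal entries elsewhere.  Only the ratio in
    coordinate m changes, and it becomes at least e^a when the common initial
    entry eps there is small enough. *)
Lemma feed_gauge_le (m : nat) (a : R) : (0 < m)%N -> (m < n)%N ->
  0 < a -> a < 1 -> a * nu (initial_ones m.+1) <= nu (initial_ones m).
Proof.
move=> m0 mn a0 a1; have n0 : (0 < n)%N by apply: ltn_trans mn.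
pose i0 := Ordinal n0; pose j := Ordinal mn.
have i0j : i0 != j by rewrite -val_eqE /= neq_ltn m0.
(* Then (eps + 1) e^a = e, so that (eps + e) / (eps + 1) >= e^a. *)
pose eps : R := expR (1 - a) - 1.
have eps0 : 0 < eps by rewrite subr_gt0 expR_gt1 subr_gt0.
pose d1 : 'rV[R]_n := \row_i (if i == j then eps else 1).
pose d2 : 'rV[R]_n :=
  \row_i (if i == j then eps else if (i < m)%N then expR 1 else 1).
have d1_gt0 i : 0 < d1 0 i by rewrite mxE; case: ifP.
have d2_gt0 i : 0 < d2 0 i.
  by rewrite mxE; case: ifP => _ //; case: ifP => _; rewrite ?expR_gt0.
have := nonexp (ltn0Sn 0) (feed_admissible i0 j)
  (pd_diag d1_gt0) (pd_diag d2_gt0) ler01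
  (feed_flow i0j d1_gt0) (feed_flow i0j d2_gt0).
have nuP := gauge_perm hnu.
rewrite !(gauge_dist_diag _ nuP) //; last first.
  move=> i; rewrite mxE ltr_pwDl// mulr_ge0 ?ler0n//; exact/ltW.
have -> : \row_i ln (d2 0 i / d1 0 i) = initial_ones m.
  apply/rowP => i; rewrite !mxE; have [->|_] := eqVneq i j.
    by rewrite divff ?gt_eqF// ln1 ltnn.
  by case: ifP => _; rewrite divr1 ?expRK ?ln1.
apply: le_trans; rewrite -gauge_scale//; apply: gauge_monotone => // i.
rewrite !mxE /= m0 (negbTE i0j).
have [->|ij] := eqVneq i j.
  rewrite /= ltnSn !mulr1 mul1r.
  have ratio : (eps + expR 1) / (eps + 1) >= expR a.
    rewrite /eps subrK ler_pdivlMr ?expR_gt0// -expRD addrC subrK.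
    by have := eps0; rewrite /eps; lra.
  rewrite gtr0_norm//; apply: le_trans (ler_norm _).
  rewrite -ler_expR lnK// posrE; exact: lt_le_trans (expR_gt0 _) ratio.
rewrite !mul0r !addr0 ltnS leq_eqVlt.
have -> : (i == m :> nat) = false by apply/negbTE; rewrite -val_eqE in ij.
case: ifP => _ /=; last by rewrite mulr0 normr0.
by rewrite divr1 expRK mulr1 normr1 gtr0_norm// ltW.
Qed.

Lemma initial_ones_le m : (0 < m)%N -> (m < n)%N ->
  nu (initial_ones m.+1) <= nu (initial_ones m).
Proof.
move=> m0 mn; rewrite leNgt; apply/negP => lt_nu.
set x := nu (initial_ones m) in lt_nu *.
set y := nu (initial_ones m.+1) in lt_nu *.
have x0 : 0 <= x by apply: gauge_ge0.
have y0 : 0 < y by apply: le_lt_trans lt_nu.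
have yx : x / y < 1 by rewrite ltr_pdivrMr// mul1r.
have xy0 : 0 <= x / y by rewrite divr_ge0// ltW.
(* For a strictly between x / y and 1 the bound a * y <= x fails. *)
have : (x / y + 1) / 2 * y <= x by apply: feed_gauge_le => //; lra.
have -> : (x / y + 1) / 2 * y = (x + y) / 2 by field; rewrite gt_eqF.
by lra.
Qed.

Lemma ones_le_first m : (0 < m)%N -> (m <= n)%N ->
  nu (initial_ones m) <= nu (initial_ones 1).
Proof.
elim: m => // -[//|m] IH _ mn.
by apply: le_trans (IH isT (ltnW mn)); apply: initial_ones_le.
Qed.

(** By monotonicity and homogeneity nu(l) lies between |l|_oo nu(e_j), where j
    is a coordinate of maximal modulus, and |l|_oo nu(1, ..., 1); these bounds
    coincide by [ones_le_first]. *)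
Lemma gauge_eq_sup_norm (hn : (0 < n)%N) l :
  nu l = nu (const_mx 1) * sup_norm l.
Proof.
pose i0 := Ordinal hn; set M := sup_norm l.
have lM i : `|l 0 i| <= M by apply: le_bigmax.
have M0 : 0 <= M by apply: le_trans (lM i0).
have [Mz|Mnz] := eqVneq M 0.
  have -> : l = 0.
    apply/rowP => i; rewrite mxE; apply/eqP.
    by rewrite -normr_le0 -Mz.
  by rewrite gauge0// Mz mulr0.
have M_gt0 : 0 < M by rewrite lt_def Mnz.
have [j _ Mj] : {j : 'I_n | j \in xpredT & M = `|l 0 j|}.
  by apply: (eq_bigmax i0) => // i _; apply: normr_ge0.
rewrite mulrC; apply/le_anti/andP; split.
  rewrite -gauge_scale//; apply: gauge_monotone => // i.
  by rewrite !mxE mulr1 (ger0_norm M0).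
have -> : const_mx 1 = initial_ones n.
  by apply/rowP => i; rewrite !mxE ltn_ord.
apply: le_trans (ler_wpM2l M0 (ones_le_first hn (leqnn n))) _.
rewrite -(gauge_perm hnu (tperm i0 j)) -gauge_scale//.
apply: gauge_monotone => // i; rewrite !mxE.
have -> : (tperm i0 j i < 1)%N = (i == j).
  rewrite ltnS leqn0 -(inj_eq (@perm_inj _ (tperm i0 j)) i j) tpermR.
  by rewrite -val_eqE.
have [->|_] := eqVneq i j; first by rewrite mulr1 Mj normr_id.
by rewrite mulr0 normr0.
Qed.

End Necessity.

Theorem theorem1p3 (R : realType) (n : nat) (hn : (0 < n)%N)
    (nu : 'rV[R]_n -> R) (hnu : symmetric_gauge nu) :
  (forall (k : nat) (p : riccati_param R n k),
      (0 < k)%N -> admissible p -> nonexpansive_flow p nu) <->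
  (exists c : R, forall l : 'rV[R]_n, nu l = c * sup_norm l).
Proof.
split=> [nonexp|[c nuE] k p _ adm P1 P2 pd1 pd2 t t0 Y1 Y2 F1 F2].
  by exists (nu (const_mx 1)) => l; apply: gauge_eq_sup_norm.
have c0 : 0 <= c.
  have := gauge_ge0 hnu (const_mx 1); rewrite nuE.
  have : 1 <= sup_norm (const_mx 1 : 'rV[R]_n).
    by apply: le_trans (le_bigmax _ _ (Ordinal hn)); rewrite mxE normr1.
  by move=> s1; rewrite pmulr_lge0//; apply: lt_le_trans s1.
have := sup_norm_nonexpansive adm pd1 pd2 t0 F1 F2.
have gaugeE P Q : gauge_dist nu P Q = c * gauge_dist sup_norm P Q.
  exact: nuE.
by move=> le_sup; rewrite !gaugeE; apply: ler_wpM2l.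
Qed.
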